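(* If $c=(c_1,\dots,c_n)$ is a representative of a quiddity cycle, then either $c$ is one of \[(0,0),\ (1,1,1),\ (1,2,1,2),\ (2,1,2,1),\ (2,1,3,1,2),\] or one of the sequences $(c_2,\dots,c_{n-1})$ or $(c_{n-1},\dots,c_2)$ contains one of \[(1,2,2),(1,2,3),(1,2,4),(2,1,3),(2,1,4),(2,1,5),(3,1,4),(3,1,5),(1,3,1,3).\]
   Context: A finite sequence is an element of $\mathbb{N}_0^n$ for some $n\ge1$. $(\!(c_1,\dots,c_n)\!)$ denotes the orbit of $(c_1,\dots,c_n)$ under the dihedral group acting on positions (rotations and reversal); its elements are called representatives. Quiddity cycles form the smallest set $\mathcal{A}$ of such orbits containing $(\!(0,0)\!)$ and such that $(\!(c_1,\dots,c_n)\!)\in\mathcal{A}$ (any representative) implies $(\!(c_1+1,1,c_2+1,c_3,\dots,c_n)\!)\in\mathcal{A}$. A finite sequence $(a_1,\dots,a_r)$ contains $(d_1,\dots,d_m)$ if there is $k\ge0$ with $k+m\le r$ and $a_{k+i}=d_i$ for $i=1,\dots,m$ (consecutive subsequence, no wrap-around). *)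

(* Defs.v *)
From mathcomp Require Import all_boot.
From mathcomp Require Import classical_sets.

Set Implicit Arguments.
Unset Strict Implicit.
Unset Printing Implicit Defensive.

Local Open Scope classical_set_scope.

(* [rot k] is the identity for [k >= size c], so [k] needs no bound. *)
Definition dihedral_orbit (c : seq nat) : set (seq nat) :=
  [set d | exists k, d = rot k c \/ d = rot k (rev c)].

(* The step applies to any representative [c1 :: c2 :: s] of a given quiddity
   cycle [O], because [O] may be written as the orbit of any of its members. *)
Inductive quiddity_cycle : set (seq nat) -> Prop :=
| quiddity_base : quiddity_cycle (dihedral_orbit [:: 0; 0])
| quiddity_step (c1 c2 : nat) (s : seq nat) :
    quiddity_cycle (dihedral_orbit [:: c1, c2 & s]) ->
    quiddity_cycle (dihedral_orbit [:: c1.+1, 1, c2.+1 & s]).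

Definition quiddity_representative (c : seq nat) : Prop :=
  exists2 O, quiddity_cycle O & O c.

(* (c_2, ..., c_(n-1)), empty when n <= 2 *)
Definition interior (c : seq nat) : seq nat := behead (take (size c).-1 c).

Definition exceptional_sequences : seq (seq nat) :=
  [:: [:: 0; 0]; [:: 1; 1; 1]; [:: 1; 2; 1; 2]; [:: 2; 1; 2; 1];
      [:: 2; 1; 3; 1; 2]].

Definition unavoidable_patterns : seq (seq nat) :=
  [:: [:: 1; 2; 2]; [:: 1; 2; 3]; [:: 1; 2; 4];
      [:: 2; 1; 3]; [:: 2; 1; 4]; [:: 2; 1; 5];
      [:: 3; 1; 4]; [:: 3; 1; 5]; [:: 1; 3; 1; 3]].

(* Main.v *)
Require Import Defs.
From mathcomp Require Import all_boot.

(** A quiddity cycle counts the triangles at the vertices of a triangulated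
    polygon.  Choosing a representative amounts to choosing a root edge, joining
    the last vertex to the first one.  The triangle on the root edge splits the
    polygon into two smaller ones rooted at its other sides, and the interiors
    of their sequences are factors of the interior of the whole sequence.  Hence
    if the whole sequence avoids the patterns then so do both parts, which by
    induction are among the five exceptional sequences; gluing any two of these
    gives a sequence that is again exceptional or contains a pattern. *)

(* [triangulation a u b]: some triangulation rooted at an edge has [a] and [b]
   triangles at the ends of the root edge and [u] at the other vertices, in
   order; the digon is the triangulation with no triangle. *)
Inductive triangulation : nat -> seq nat -> nat -> Prop :=
| triangulation_digon : triangulation 0 [::] 0
| triangulation_glue a u b c v d :
    triangulation a u b -> triangulation c v d ->
    triangulation a.+1 (u ++ (b + c).+1 :: v) d.+1.

Definition triangulated (s : seq nat) : Prop :=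
  exists a u b, s = a :: rcons u b /\ triangulation a u b.

Lemma triangulation_rev a u b :
  triangulation a u b -> triangulation b (rev u) a.
Proof.
elim=> [|{}a {}u {}b c v d _ IHu _ IHv]; first exact: triangulation_digon.
rewrite rev_cat rev_cons cat_rcons addnC.
exact: triangulation_glue.
Qed.

(* Gluing two triangulations along their root edges and re-rooting the result
   at the first side of the first one.  If that one is itself glued from [A]
   and [B], then [B] may be moved to the other triangulation, which reduces the
   claim to [A]. *)
Lemma triangulation_reroot a u b c v d :
  triangulation a u b -> triangulation c v d ->
  triangulated (rcons (u ++ b + c :: v) (d + a)).
Proof.
move=> tri_u; elim: tri_u c v d
  => [|{}a {}u {}b a' u' b' _ IHu tri_u' _] c v d tri_v.
  by exists c, v, d; rewrite addn0.
have := IHu _ _ _ (triangulation_glue _ _ _ _ _ _ tri_u' tri_v).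
by rewrite -catA /= !addSn !addnS.
Qed.

Lemma triangulated_rev s : triangulated s -> triangulated (rev s).
Proof.
move=> [a [u [b [-> tri]]]]; exists b, (rev u), a.
by rewrite rev_cons rev_rcons; split=> //; apply: triangulation_rev.
Qed.

Lemma triangulated_rot k s : triangulated s -> triangulated (rot k s).
Proof.
move=> tri_s; have [le_ks|/ltnW/rot_oversize-> //] := leqP k (size s).
elim: k le_ks => [|k IHk] lt_ks; first by rewrite rot0.
rewrite -addn1 addnC rotD ?add1n //.
have [a [u [b [-> tri_u]]]] := IHk (ltnW lt_ks).
(* Gluing on a digon adds no triangle, so this only moves the root edge on by one side. *)
have := triangulation_reroot _ _ _ _ _ _ tri_u triangulation_digon.
by rewrite addn0 add0n rot1_cons cats1.
Qed.

(** The new triangle sits on the side joining the first two vertices: re-root there, then glue with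
    a digon as first part. *)
Lemma triangulated_ear c1 c2 s :
  triangulated [:: c1, c2 & s] -> triangulated [:: c1.+1, 1, c2.+1 & s].
Proof.
move=> /(triangulated_rot 1); rewrite rot1_cons.
move=> [a [u [b [[-> /rcons_inj[-> ->]] tri_u]]]].
rewrite -(rotK 1 [:: b.+1, 1, a.+1 & u]) rot1_cons.
apply: triangulated_rot; exists 1, (a.+1 :: u), b.+1; split=> //.
exact: triangulation_glue triangulation_digon tri_u.
Qed.

Lemma quiddity_representative_triangulated c :
  quiddity_representative c -> triangulated c.
Proof.
suff orbit_tri s : triangulated s ->
    forall t, dihedral_orbit s t -> triangulated t.
  case=> O qO; elim: qO c => [|c1 c2 s _ IH]; apply: orbit_tri.
    by exists 0, [::], 0; split=> //; apply: triangulation_digon.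
  by apply/triangulated_ear/IH; exists 0; left; rewrite rot0.
move=> tri_s t [k [] ->]; apply: triangulated_rot => //.
exact: triangulated_rev.
Qed.

Definition has_pattern (u : seq nat) : bool :=
  has (fun d => infix d u || infix d (rev u)) unavoidable_patterns.

Lemma has_pattern_infix u v : infix u v -> has_pattern u -> has_pattern v.
Proof.
move=> uv; apply: sub_has => d /orP[du|du]; apply/orP; [left|right].
  exact: infix_trans uv.
by apply: infix_trans du _; rewrite infix_rev.
Qed.

Lemma interior_cons_rcons a u b : interior (a :: rcons u b) = u.
Proof. by rewrite /interior /= size_rcons /= -cats1 take_size_cat. Qed.

(** Only 25 pairs occur, so evaluation decides. All five sequences are nonempty, so the default [0]
    is never returned. *)
Lemma glue_exceptional s t :
  s \in exceptional_sequences -> t \in exceptional_sequences ->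
  let w := interior s ++ (last 0 s + head 0 t).+1 :: interior t in
  ((head 0 s).+1 :: rcons w (last 0 t).+1 \in exceptional_sequences)
    || has_pattern w.
Proof. by move: s t; apply/allrelP; vm_compute. Qed.

Lemma triangulation_unavoidable a u b : triangulation a u b ->
  (a :: rcons u b \in exceptional_sequences) || has_pattern u.
Proof.
elim=> [|{}a {}u {}b c v d _ IHu _ IHv] //.
case/orP: IHu => [exc_u|pat_u]; last first.
  by rewrite (has_pattern_infix _ _ _ pat_u) ?orbT // prefix_infix ?prefix_prefix.
case/orP: IHv => [exc_v|pat_v]; last first.
  rewrite (has_pattern_infix _ _ _ pat_v) ?orbT //.
  by rewrite -cat_rcons suffix_infix ?suffix_suffix.
have := glue_exceptional _ _ exc_u exc_v.
by rewrite /= !interior_cons_rcons !last_rcons.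
Qed.

Theorem theorem2p12 (c : seq nat) (hc : quiddity_representative c) :
  c \in exceptional_sequences \/
  exists2 d : seq nat, d \in unavoidable_patterns &
    infix d (interior c) \/ infix d (rev (interior c)).
Proof.
have [a [u [b [-> tri_u]]]] := quiddity_representative_triangulated _ hc.
rewrite interior_cons_rcons.
case/orP: (triangulation_unavoidable _ _ _ tri_u) => [|/hasP[d d_pat /orP]].
  by left.
by right; exists d.
Qed.
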